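(* Let $m\ge 2$ and let $f_1,\ldots,f_m:\mathbb{R}^2\to\mathbb{R}$ be functions such that for all $1\le i<j\le m$ the vector field $\mathbf{F}_{ij}=(f_i(x_i,x_j),f_j(x_i,x_j))$ on $\mathbb{R}^2$ (with coordinates $(x_i,x_j)$) is continuously differentiable. Consider the control system with state variables $x_i$ ($1\le i\le m$) and $x_{ij}$ ($1\le i<j\le m$) and inputs $u_1,\ldots,u_m$, $$\dot{x}_i=u_i,\quad i=1,\ldots,m,\qquad \dot{x}_{ij}=f_i(x_i,x_j)u_i+f_j(x_i,x_j)u_j,\quad 1\le i<j\le m.$$ The following are equivalent: (1) The system is controllable. (2) For each $1\le i<j\le m$, there exists a closed loop $\gamma$ in $\mathbb{R}^2$ such that the line integral $\oint_{\gamma}\mathbf{F}_{ij}\cdot d\mathbf{x}\neq 0$. (3) For each $1\le i<j\le m$, the curl $\nabla\times\mathbf{F}_{ij}$ is not identically zero on $\mathbb{R}^2$.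
   Context: The state space is $\mathbb{R}^{m+m(m-1)/2}$. The system is controllable if for every pair of states $p,q$ in the state space there exist a finite time $T>0$ and piecewise continuous real-valued inputs on $[0,T]$ whose corresponding trajectory starts at $p$ at time $0$ and is at $q$ at time $T$. A closed loop is a piecewise continuously differentiable closed curve. For a planar vector field $\mathbf{F}_{ij}=(f_i(x_i,x_j),f_j(x_i,x_j))$ in the coordinates $(x_i,x_j)$, the curl $\nabla\times\mathbf{F}_{ij}$ is $\frac{\partial}{\partial x_i}f_j(x_i,x_j)-\frac{\partial}{\partial x_j}f_i(x_i,x_j)$. *)

(* Defs.v *)
From Stdlib Require Import Reals.
From Coquelicot Require Import Coquelicot.
From mathcomp Require Import all_boot.

Set Implicit Arguments.
Unset Strict Implicit.
Unset Printing Implicit Defensive.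

Local Open Scope R_scope.

(** ** Piecewise regularity on an interval *)

Definition Icc (a b : R) (t : R) : Prop := a <= t <= b.

(* [P] holds on every piece [t_k, t_{k+1}] of some finite subdivision of
   [a, b]. *)
Definition piecewise (P : R -> R -> Prop) (a b : R) : Prop :=
  exists (n : nat) (t : nat -> R),
    t 0%N = a /\ t n = b /\
    forall k : nat, (k < n)%N -> t k < t k.+1 /\ P (t k) (t k.+1).

(* The value of [v] at the endpoints of a piece is arbitrary. *)
Definition continuous_piece (v : R -> R) (c d : R) : Prop :=
  (forall t, c < t < d -> continuous v t) /\
  (exists l : R, filterlim v (at_right c) (locally l)) /\
  (exists l : R, filterlim v (at_left d) (locally l)).

Definition piecewise_continuous (v : R -> R) (a b : R) : Prop :=
  piecewise (continuous_piece v) a b.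

(* Continuous differentiability on the closed interval [c, d]: derivatives are
   taken relative to [c, d], hence are one-sided at [c] and [d]. *)
Definition C1_on (g : R -> R) (c d : R) : Prop :=
  exists g' : R -> R,
    continuous_on (Icc c d) g' /\
    forall t, Icc c d t ->
      filterlim (fun s => (g s - g t) / (s - t))
        (within (fun s => Icc c d s /\ s <> t) (locally t)) (locally (g' t)).

(** ** Planar vector fields and closed loops *)

Definition partial1 (h : R * R -> R) (p : R * R) : R :=
  Derive (fun s => h (s, p.2)) p.1.

Definition partial2 (h : R * R -> R) (p : R * R) : R :=
  Derive (fun s => h (p.1, s)) p.2.

Definition C1_plane (h : R * R -> R) : Prop :=
  forall p : R * R,
    ex_derive (fun s => h (s, p.2)) p.1 /\
    ex_derive (fun s => h (p.1, s)) p.2 /\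
    continuous (partial1 h) p /\ continuous (partial2 h) p.

Definition C1_field (F : R * R -> R * R) : Prop :=
  C1_plane (fun p => (F p).1) /\ C1_plane (fun p => (F p).2).

Definition curl (F : R * R -> R * R) (p : R * R) : R :=
  partial1 (fun q => (F q).2) p - partial2 (fun q => (F q).1) p.

(* Continuity of [g] on [a, b] is implied: consecutive closed pieces share
   their common endpoint. *)
Definition closed_loop (g : R -> R * R) (a b : R) : Prop :=
  a < b /\ g a = g b /\
  piecewise (fun c d => C1_on (fun t => (g t).1) c d /\
                        C1_on (fun t => (g t).2) c d) a b.

(* [Derive] returns a junk value at the corners of [g], which are finitely many
   and do not affect the integral. *)
Definition line_integral (F : R * R -> R * R) (g : R -> R * R) (a b : R) : R :=
  RInt (fun t => (F (g t)).1 * Derive (fun s => (g s).1) t +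
                 (F (g t)).2 * Derive (fun s => (g s).2) t) a b.

(** ** Control systems x' = G(x, u), with coordinates of the state indexed by
    [I] and inputs indexed by [J] *)

(* A trajectory is continuous and solves the differential equation wherever the
   inputs are continuous, that is, for piecewise continuous inputs, at all but
   finitely many times. *)
Definition trajectory (I J : Type) (G : (I -> R) -> (J -> R) -> (I -> R))
    (T : R) (u : R -> J -> R) (x : R -> I -> R) : Prop :=
  (forall k : I, continuous_on (Icc 0 T) (fun t => x t k)) /\
  (forall t : R, 0 < t < T -> (forall j : J, continuous (fun s => u s j) t) ->
     forall k : I, is_derive (fun s => x s k) t (G (x t) (u t) k)).

Definition controllable (I J : Type)
    (G : (I -> R) -> (J -> R) -> (I -> R)) : Prop :=
  forall p q : I -> R,
    exists (T : R) (u : R -> J -> R) (x : R -> I -> R),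
      0 < T /\
      (forall j : J, piecewise_continuous (fun t => u t j) 0 T) /\
      trajectory G T u x /\ x 0 = p /\ x T = q.

(** ** The system x_i' = u_i, x_ij' = f_i(x_i, x_j) u_i + f_j(x_i, x_j) u_j *)

Definition pair_index (m : nat) : Type :=
  {ij : 'I_m * 'I_m | (ij.1 < ij.2)%N}.

(* m + m (m - 1) / 2 coordinates: [inl i] is x_i and [inr (i, j)] is x_ij. *)
Definition state_index (m : nat) : Type := ('I_m + pair_index m)%type.

Definition pair_field (m : nat) (f : 'I_m -> R * R -> R) (i j : 'I_m) :
    R * R -> R * R :=
  fun p => (f i p, f j p).

Definition system (m : nat) (f : 'I_m -> R * R -> R)
    (x : state_index m -> R) (u : 'I_m -> R) (k : state_index m) : R :=
  match k with
  | inl i => u i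
  | inr ij =>
      let: (i, j) := sval ij in
      f i (x (inl i), x (inl j)) * u i + f j (x (inl i), x (inl j)) * u j
  end.

(* Main.v *)
Require Import Defs.
From Stdlib Require Import Reals Lra List FunctionalExtensionality Classical.
From Coquelicot Require Import Coquelicot.
From mathcomp Require Import all_boot.

(** Everything rests on the circulation of a planar field around a rectangle with
   one corner fixed at [(a, b)] and the opposite corner at [(x, y)]
   ([rectangle_integral]).  Its mixed second derivative in [x] and [y] is the curl
   at [(x, y)], so if all these circulations vanish then so does the curl on the
   whole plane ([rectangle_integral_curl]).  Conversely a curl-free field is a
   gradient ([curl0_gradient]), whose integral around any closed loop is zero
   ([gradient_closed_loop]).  This gives the equivalence of the loop condition and
   the curl condition ([closed_loop_curl]).

   If the field of a pair [(i, j)] has a potential [phi], then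
   [x_ij - phi (x_i, x_j)] is constant along every trajectory, so the system is not
   controllable ([controllable_curl]).

   Suppose that every curl is nonzero somewhere.  The positions [x_i] can be moved
   freely, one at a time ([reachable_move]), and moves can be concatenated
   ([reachable_trans]); only the coordinates [x_ij] need an argument.  Driving
   [(x_i, x_j)] around a rectangle and back, with the other positions at rest, adds
   the circulation to [x_ij] and changes nothing else: every other pair sees at most
   one moving position, which travels back and forth over the same segment
   ([rectangle_moves]).  A rectangle based at the current positions has nonzero
   circulation for suitable [(x, y)]; narrowing, reversing and repeating it adds any
   real number to [x_ij] ([linked_bump]).  So the positions are brought to their
   targets, and then the pairs are corrected independently
   ([curl_controllable]). *)

Local Open Scope R_scope.

(** * One-sided continuity and the fundamental theorem of calculus *)

(** Composing with this retraction onto [[a, b]] turns a function that is only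
   continuous relative to [[a, b]] into one that is continuous on the whole line,
   where two-sided results apply. *)
Definition clamp (a b t : R) : R := Rmax a (Rmin b t).

Lemma clamp_in a b t : a <= b -> Icc a b (clamp a b t).
Proof.
move=> ab; rewrite /Icc /clamp /Rmin.
by case: Rle_dec => ?; rewrite /Rmax; case: Rle_dec => ?; lra.
Qed.

Lemma clamp_id a b t : Icc a b t -> clamp a b t = t.
Proof.
rewrite /Icc /clamp /Rmin => h.
by case: Rle_dec => ?; rewrite /Rmax; case: Rle_dec => ?; lra.
Qed.

Lemma clamp_below a b t : a <= b -> t <= a -> clamp a b t = a.
Proof.
move=> ab ta; rewrite /clamp Rmax_left //.
by apply: Rle_trans ta; exact: Rmin_r.
Qed.

Lemma clamp_above a b t : a <= b -> b <= t -> clamp a b t = b.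
Proof. by move=> ab bt; rewrite /clamp Rmin_left // Rmax_right. Qed.

Lemma continuous_clamp a b t : continuous (clamp a b) t.
Proof.
apply/filterlim_locally => eps; exists eps => s.
rewrite /ball /= /AbsRing_ball /abs /minus /plus /opp /= /clamp => h.
apply: Rle_lt_trans h; rewrite /Rmin.
by do ?case: Rle_dec => ?; rewrite /Rmax; do ?case: Rle_dec => ?;
   rewrite /Rabs; do ?case: Rcase_abs => ?; lra.
Qed.

Lemma continuous_on_clamp (h : R -> R) a b t : a <= b ->
  continuous_on (Icc a b) h -> continuous (fun s => h (clamp a b s)) t.
Proof.
move=> ab hc.
have hin s : Icc a b (clamp a b s) by exact: clamp_in.
apply: (filterlim_comp _ _ _ (clamp a b) h _
          (within (Icc a b) (locally (clamp a b t)))); last exact: hc.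
move=> P hP.
have := continuous_clamp a b t _ hP.
rewrite /filtermap; apply: filter_imp => s; apply; exact: hin.
Qed.

Lemma continuous_on_pair (D : R -> Prop) (f g : R -> R) :
  continuous_on D f -> continuous_on D g ->
  continuous_on D (fun t => (f t, g t)).
Proof.
move=> cf cg t ht; apply/filterlim_locally => eps.
apply: filter_and.
- exact: cf t ht _ (locally_ball _ eps).
- exact: cg t ht _ (locally_ball _ eps).
Qed.

Lemma continuous_on_comp_pair (h : R * R -> R) (D : R -> Prop) (f g : R -> R) :
  (forall p, continuous h p) ->
  continuous_on D f -> continuous_on D g ->
  continuous_on D (fun t => h (f t, g t)).
Proof.
move=> ch cf cg t ht.
apply: (filterlim_comp _ _ _ (fun t => (f t, g t)) h); last exact: ch.
exact: continuous_on_pair.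
Qed.

Lemma locally_open_interval a b t : a < t < b -> locally t (fun s => a < s < b).
Proof.
move=> ht; apply: filter_and.
- by apply: open_gt; lra.
- by apply: open_lt; lra.
Qed.

Lemma constant_of_zero_derive (h : R -> R) a b : a <= b ->
  continuous_on (Icc a b) h -> (forall t, a < t < b -> is_derive h t 0) ->
  h b = h a.
Proof.
move=> ab hc hd.
have [| |c [_]] := MVT_gen (fun s => h (clamp a b s)) a b (fun=> 0).
- rewrite Rmin_left // Rmax_right // => t ht.
  apply: (is_derive_ext_loc h); last exact: hd.
  apply: filter_imp (locally_open_interval _ _ _ ht) => s hs.
  by rewrite clamp_id // /Icc; lra.
- by move=> t _; apply/continuity_pt_filterlim; apply: continuous_on_clamp.
by rewrite !clamp_id /Icc; lra.
Qed.

(** Cutting the interval at an exceptional point leaves two intervals, each with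
   one exceptional point fewer; continuity joins the two constants.  Trajectories
   are required to satisfy the differential equation only off such a set. *)
Lemma constant_off_finite (L : list R) (h : R -> R) a b : a <= b ->
  continuous_on (Icc a b) h ->
  (forall t, a < t < b -> ~ In t L -> is_derive h t 0) -> h b = h a.
Proof.
elim: L a b => [|c L IH] a b ab hc hd.
  by apply: constant_of_zero_derive => // t ht; apply: hd => // -[].
have [hcab|hcab] := classic (a < c < b); last first.
  apply: IH => // t ht hL; apply: hd => // -[ctE|//].
  by apply: hcab; rewrite ctE.
have sub a' b' : a <= a' -> b' <= b -> continuous_on (Icc a' b') h.
  move=> aa bb; apply: continuous_on_subset hc => t; rewrite /Icc; lra.
transitivity (h c).
  apply: IH; [lra|by apply: sub; lra|] => t ht hL; apply: hd; first lra.
  by move=> -[ctE|//]; lra.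
apply: IH; [lra|by apply: sub; lra|] => t ht hL; apply: hd; first lra.
by move=> -[ctE|//]; lra.
Qed.

Lemma continuous_RInt_is_derive (f : R -> R) a x :
  (forall s, continuous f s) -> is_derive (RInt f a) x (f x).
Proof.
move=> hf; apply: (is_derive_RInt f _ a) => //.
apply: filter_forall => b; apply: RInt_correct.
by apply: ex_RInt_continuous => s _.
Qed.

(** A fundamental theorem of calculus for a closed piece: [H] may fail to be
   differentiable at [c] and [d], and [k] may be arbitrary there.  The difference
   between [H] and a primitive of the continuous extension [kc] of [k] has zero
   derivative inside the piece. *)
Lemma is_RInt_of_derive_interior (k kc H : R -> R) c d : c <= d ->
  continuous_on (Icc c d) H -> continuous_on (Icc c d) kc ->
  (forall t, c < t < d -> is_derive H t (kc t) /\ k t = kc t) ->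
  is_RInt k c d (H d - H c).
Proof.
move=> cd cH ck hd.
set kk := fun s => kc (clamp c d s).
have ckk s : continuous kk s by apply: continuous_on_clamp.
have dI t : is_derive (RInt kk c) t (kk t) by apply: continuous_RInt_is_derive.
(* [H - RInt kk c] is constant on the piece. *)
have -> : H d - H c = RInt kk c d.
  have := @constant_of_zero_derive (fun t => H t - RInt kk c t) c d cd.
  rewrite RInt_point /zero /= => E.
  suff : H d - RInt kk c d = H c - 0 by lra.
  apply: E.
    apply: (continuous_on_comp_pair (fun p => p.1 - p.2)) => //.
      by move=> p; apply: continuous_minus; [exact: continuous_fst|exact: continuous_snd].
    apply: continuous_on_forall => t _.
    by apply: ex_derive_continuous; exists (kk t).
  move=> t ht; have -> : 0 = minus (kc t) (kk t).
    by rewrite /kk clamp_id /Icc; [rewrite /minus /plus /opp /=; ring|lra].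
  by apply: is_derive_minus => //; case: (hd t ht).
apply: (is_RInt_ext kk).
  rewrite Rmin_left // Rmax_right // => t ht.
  by rewrite /kk clamp_id /Icc; [case: (hd t ht)|lra].
by apply: RInt_correct; apply: ex_RInt_continuous.
Qed.

(** * Planar fields: potentials, rectangles and the curl *)

Definition is_gradient (h dx dy : R * R -> R) : Prop :=
  forall x y, is_derive (fun s => h (s, y)) x (dx (x, y)) /\
              is_derive (fun s => h (x, s)) y (dy (x, y)).

(** Two partial derivatives, one of them continuous, give total differentiability. *)
Lemma gradient_differentiable (h dx dy : R * R -> R) x y :
  is_gradient h dx dy -> (forall p, continuous dx p) ->
  differentiable_pt_lim (fun u v => h (u, v)) x y (dx (x, y)) (dy (x, y)).
Proof.
move=> dh cdx; apply/filterdiff_differentiable_pt_lim.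
apply: (is_derive_filterdiff (fun u v => h (u, v)) x y (fun u v => dx (u, v))).
- by apply: filter_forall => -[u v] /=; case: (dh u v).
- by case: (dh x y).
- apply: continuous_ext (cdx (x, y)) => -[u v] //.
Qed.

Lemma differentiable_continuous (h : R * R -> R) x y lx ly :
  differentiable_pt_lim (fun u v => h (u, v)) x y lx ly -> continuous h (x, y).
Proof.
move=> dh.
have /differentiable_continuity_pt/continuity_2d_pt_filterlim :
  differentiable_pt (fun u v => h (u, v)) x y by exists lx, ly.
by apply: filterlim_ext => -[u v].
Qed.

Lemma C1_plane_gradient h : C1_plane h -> is_gradient h (partial1 h) (partial2 h).
Proof.
by move=> hh x y; have [h1 [h2 _]] := hh (x, y); split; apply: Derive_correct.
Qed.

Lemma C1_plane_continuous h p : C1_plane h -> continuous h p.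
Proof.
move=> hh; case: p => x y.
apply: differentiable_continuous; apply: gradient_differentiable.
  exact: C1_plane_gradient.
by move=> p; have [_ [_ [c _]]] := hh p.
Qed.

Lemma gradient_chain (h dx dy : R * R -> R) (g1 g2 : R -> R) t l1 l2 :
  is_gradient h dx dy -> (forall p, continuous dx p) ->
  is_derive g1 t l1 -> is_derive g2 t l2 ->
  is_derive (fun s => h (g1 s, g2 s)) t
    (dx (g1 t, g2 t) * l1 + dy (g1 t, g2 t) * l2).
Proof.
move=> dh cdx /is_derive_Reals d1 /is_derive_Reals d2; apply/is_derive_Reals.
apply: (derivable_pt_lim_comp_2d (fun u v => h (u, v))) => //.
exact: gradient_differentiable.
Qed.

Lemma continuous_line1 (h : R * R -> R) x y :
  continuous h (x, y) -> continuous (fun s => h (s, y)) x.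
Proof.
move=> ch; apply: (continuous_comp_2 (fun s => s) (fun=> y) (fun u v => h (u, v))).
- exact: continuous_id.
- exact: continuous_const.
- by apply: continuous_ext ch => -[].
Qed.

Lemma continuous_line2 (h : R * R -> R) x y :
  continuous h (x, y) -> continuous (fun s => h (x, s)) y.
Proof.
move=> ch; apply: (continuous_comp_2 (fun=> x) (fun s => s) (fun u v => h (u, v))).
- exact: continuous_const.
- exact: continuous_id.
- by apply: continuous_ext ch => -[].
Qed.

(** The integral of the field along the horizontal segment from [(a, b)] to
   [(p.1, b)], followed by the vertical segment up to [p].  Its derivative in the
   second variable is always [F2]; its derivative in the first is [F1]
   exactly when the field is curl-free. *)
Definition corner_integral (F1 F2 : R * R -> R) (a b : R) (p : R * R) : R :=
  RInt (fun s => F1 (s, b)) a p.1 + RInt (fun s => F2 (p.1, s)) b p.2.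

Section Planar.

Variables F1 F2 : R * R -> R.
Hypotheses (C1 : C1_plane F1) (C2 : C1_plane F2).

Let line1 y s : continuous (fun s => F1 (s, y)) s.
Proof. by apply: continuous_line1; apply: C1_plane_continuous. Qed.
Let line2 x s : continuous (fun s => F2 (x, s)) s.
Proof. by apply: continuous_line2; apply: C1_plane_continuous. Qed.

Lemma corner_integral_partial1 a b x y :
  is_derive (fun s => corner_integral F1 F2 a b (s, y)) x
    (F1 (x, b) + RInt (fun s => partial1 F2 (x, s)) b y).
Proof.
apply: (is_derive_plus (RInt (fun s => F1 (s, b)) a)).
  exact: (continuous_RInt_is_derive (fun s => F1 (s, b))).
apply: (is_derive_RInt_param (fun u v => F2 (u, v))).
- apply: filter_forall => u t _; by have [] := C2 (u, t).
- move=> t _; apply/continuity_2d_pt_filterlim.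
  have [_ [_ [c _]]] := C2 (x, t).
  by apply: filterlim_ext c => -[].
- apply: filter_forall => u; by apply: ex_RInt_continuous.
Qed.

Lemma corner_integral_partial2 a b x y :
  is_derive (fun s => corner_integral F1 F2 a b (x, s)) y (F2 (x, y)).
Proof.
rewrite -[F2 _]Rplus_0_l.
apply: (is_derive_plus (fun=> RInt (fun s => F1 (s, b)) a x)).
  exact: is_derive_const.
exact: (continuous_RInt_is_derive (fun s => F2 (x, s))).
Qed.

(** The Poincare lemma in the plane: when the curl vanishes, the integral in
   [corner_integral_partial1] becomes that of the derivative of [F1 (x, .)] and
   telescopes to [F1 (x, y) - F1 (x, b)]. *)
Lemma curl0_gradient a b :
  (forall p, partial1 F2 p = partial2 F1 p) ->
  is_gradient (corner_integral F1 F2 a b) F1 F2.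
Proof.
move=> curl0 x y; split; last exact: corner_integral_partial2.
have := corner_integral_partial1 a b x y.
suff -> : RInt (fun s => partial1 F2 (x, s)) b y = F1 (x, y) - F1 (x, b).
  by rewrite Rplus_minus.
apply: is_RInt_unique; apply: (is_RInt_derive (fun s => F1 (x, s))).
  by move=> s _; rewrite curl0; case: (C1_plane_gradient F1 C1 x s).
move=> s _; apply: continuous_line2; by have [_ [_ []]] := C2 (x, s).
Qed.

(** The circulation around the rectangle with opposite corners [(a, b)] and
   [(x, y)], which may be degenerate or negatively oriented. *)
Definition rectangle_integral (a b x y : R) : R :=
  RInt (fun s => F1 (s, b)) a x + RInt (fun s => F2 (x, s)) b y
  + RInt (fun s => F1 (s, y)) x a + RInt (fun s => F2 (a, s)) y b.

Lemma rectangle_integralE a b x y :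
  rectangle_integral a b x y = corner_integral F1 F2 a b (x, y)
    - RInt (fun s => F1 (s, y)) a x - RInt (fun s => F2 (a, s)) b y.
Proof.
rewrite /rectangle_integral /corner_integral /=.
rewrite -[RInt _ x a]opp_RInt_swap; last by apply: ex_RInt_continuous.
rewrite -[RInt _ y b]opp_RInt_swap; last by apply: ex_RInt_continuous.
rewrite /opp /=; ring.
Qed.

Lemma rectangle_integral_partial1 a b x y :
  is_derive (fun s => rectangle_integral a b s y) x
    (F1 (x, b) + RInt (fun s => partial1 F2 (x, s)) b y - F1 (x, y)).
Proof.
apply: (is_derive_ext _ _ _ _ (fun s => esym (rectangle_integralE a b s y))).
rewrite -[X in is_derive _ _ X]Rminus_0_r.
apply: is_derive_minus; last exact: is_derive_const.
apply: is_derive_minus; first exact: corner_integral_partial1.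
exact: (continuous_RInt_is_derive (fun s => F1 (s, y))).
Qed.

(** The mixed second derivative of the circulation in [x] and [y] is the curl at
   [(x, y)].  Hence rectangles with one fixed corner already detect a nonzero curl
   anywhere in the plane. *)
Lemma rectangle_integral_curl a b :
  (forall x y, rectangle_integral a b x y = 0) ->
  forall p, partial1 F2 p = partial2 F1 p.
Proof.
move=> W0 [x y].
(* The first derivative of the circulation vanishes; differentiating this identity
   in [v] gives the curl. *)
have E v : F1 (x, b) + RInt (fun s => partial1 F2 (x, s)) b v = F1 (x, v).
  have D := rectangle_integral_partial1 a b x v.
  have := is_derive_unique _ _ _ D.
  rewrite (Derive_ext _ (fun=> 0)) => [|s]; last exact: W0.
  by rewrite Derive_const => E; apply: Rminus_diag_uniq; rewrite -E.
have c s : continuous (fun s => partial1 F2 (x, s)) s.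
  by apply: continuous_line2; have [_ [_ []]] := C2 (x, s).
have D : is_derive (fun v => F1 (x, v)) y (partial1 F2 (x, y)).
  apply: is_derive_ext E _.
  rewrite -[partial1 _ _]Rplus_0_l; apply: is_derive_plus.
    exact: is_derive_const.
  exact: (continuous_RInt_is_derive (fun s => partial1 F2 (x, s))).
by rewrite -(is_derive_unique _ _ _ D).
Qed.

End Planar.

(** * Regularity of pieces of curves *)

Lemma C1_on_continuous (g : R -> R) c d : C1_on g c d -> continuous_on (Icc c d) g.
Proof.
move=> [g' [_ dg]] t ht.
(* The difference quotient controls [g] only at points other than [t]. *)
have lim : filterlim g (within (fun s => Icc c d s /\ s <> t) (locally t))
             (locally (g t)).
  apply: (filterlim_within_ext _ (fun s => g t + (g s - g t) / (s - t) * (s - t))).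
    by move=> s [_ st]; field; lra.
  have -> : locally (g t) = locally (g t + g' t * (t - t)).
    by rewrite Rminus_diag Rmult_0_r Rplus_0_r.
  apply: (filterlim_comp_2 (G := locally (g t)) (H := locally (g' t * (t - t)))
    (fun=> g t) _ Rplus).
  - exact: filterlim_const.
  - apply: (filterlim_comp_2 (G := locally (g' t)) (H := locally (t - t))
      _ _ Rmult).
    + exact: dg.
    + apply: (filterlim_filter_le_1 _ (filter_le_within _)).
      by apply: (continuous_minus (fun s => s) (fun=> t));
         [exact: continuous_id|exact: continuous_const].
    + exact: (filterlim_mult (g' t) (t - t)).
  - exact: (filterlim_plus (g t) (g' t * (t - t))).
move=> P hP; have := lim P hP; rewrite /filtermap /within.
apply: filter_imp => s Ps cs; have [->|st] := classic (s = t).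
  exact: locally_singleton.
exact: Ps.
Qed.

Lemma C1_on_is_derive (g g' : R -> R) c d t : c < t < d ->
  filterlim (fun s => (g s - g t) / (s - t))
    (within (fun s => Icc c d s /\ s <> t) (locally t)) (locally (g' t)) ->
  is_derive g t (g' t).
Proof.
move=> ht dg; apply/is_derive_Reals => eps eps0.
have := dg _ (locally_ball _ (mkposreal eps eps0)) => /=.
rewrite /filtermap /within => near.
have [del hdel] := filter_and _ _ near (locally_open_interval _ _ _ ht).
exists del => h h0 hh; have [] := hdel (t + h).
  by rewrite /ball /= /AbsRing_ball /abs /minus /plus /opp /= Rplus_comm -Rplus_assoc Rplus_opp_l Rplus_0_l.
have -> : t + h - t = h by ring.
move=> + hth; apply; rewrite /Icc; lra.
Qed.

Lemma C1_on_affine (g : R -> R) al be c d :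
  (forall t, Icc c d t -> g t = al + be * t) -> C1_on g c d.
Proof.
move=> gE; exists (fun=> be); split.
  by apply: continuous_on_forall => t _; apply: continuous_const.
move=> t ht; apply: (filterlim_within_ext _ (fun=> be)); last exact: filterlim_const.
by move=> s [hs st]; rewrite !gE //; field; lra.
Qed.

Lemma is_derive_affine (g : R -> R) al be c d t : c < t < d ->
  (forall t, Icc c d t -> g t = al + be * t) -> is_derive g t be.
Proof.
move=> ht gE; apply: (is_derive_ext_loc (fun s => al + be * s)).
  apply: filter_imp (locally_open_interval _ _ _ ht) => s hs.
  by rewrite gE /Icc; lra.
by auto_derive; lra.
Qed.

(** * Line integrals along closed loops *)

Section Loops.

Variable F : R * R -> R * R.
Let F1 p := (F p).1.
Let F2 p := (F p).2.
Hypotheses (C1 : C1_plane F1) (C2 : C1_plane F2).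

Let integrand (g : R -> R * R) (t : R) :=
  F1 (g t) * Derive (fun s => (g s).1) t + F2 (g t) * Derive (fun s => (g s).2) t.

Lemma gradient_line_integral_piece (h : R * R -> R) (g : R -> R * R) c d :
  is_gradient h F1 F2 -> c < d ->
  C1_on (fun t => (g t).1) c d -> C1_on (fun t => (g t).2) c d ->
  is_RInt (integrand g) c d (h (g d) - h (g c)).
Proof.
move=> dh cd c1 c2.
have cg1 := C1_on_continuous _ _ _ c1; have cg2 := C1_on_continuous _ _ _ c2.
case: c1 c2 => [g1' [cg1' d1]] [g2' [cg2' d2]].
have cF1 p : continuous F1 p by apply: C1_plane_continuous.
have cF2 p : continuous F2 p by apply: C1_plane_continuous.
have gE t : g t = ((g t).1, (g t).2) by case: (g t).
have cFg (G : R * R -> R) : (forall p, continuous G p) -> continuous_on (Icc c d) (fun t => G (g t)).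
  move=> cG; apply: (continuous_on_ext (Icc c d) (fun t => G ((g t).1, (g t).2))).
    by move=> t _; rewrite -gE.
  exact: continuous_on_comp_pair.
apply: (is_RInt_of_derive_interior _
  (fun t => F1 (g t) * g1' t + F2 (g t) * g2' t) (fun t => h (g t))).
- lra.
- apply: cFg => -[x y]; apply: differentiable_continuous.
  exact: gradient_differentiable dh cF1.
- have cM G g' : continuous_on (Icc c d) G -> continuous_on (Icc c d) g' ->
      continuous_on (Icc c d) (fun t => G t * g' t).
    move=> cG cg'; apply: (continuous_on_comp_pair (fun p => p.1 * p.2)) => // p.
    by apply: continuous_mult; [exact: continuous_fst|exact: continuous_snd].
  apply: (continuous_on_comp_pair (fun p => p.1 + p.2)).
  + move=> p.
    by apply: continuous_plus; [exact: continuous_fst|exact: continuous_snd].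
  + by apply: cM => //; apply: cFg.
  + by apply: cM => //; apply: cFg.
- move=> t ht.
  have dg1 : is_derive (fun s => (g s).1) t (g1' t).
    by apply: (C1_on_is_derive _ _ c d) => //; apply: d1; rewrite /Icc; lra.
  have dg2 : is_derive (fun s => (g s).2) t (g2' t).
    by apply: (C1_on_is_derive _ _ c d) => //; apply: d2; rewrite /Icc; lra.
  split.
    have := gradient_chain _ _ _ _ _ _ _ _ dh cF1 dg1 dg2.
    rewrite -gE; apply: is_derive_ext => s; by rewrite -gE.
  by rewrite /integrand (is_derive_unique _ _ _ dg1) (is_derive_unique _ _ _ dg2).
Qed.

(** On each piece the integrand is the derivative of [h] along the curve, so the
   contributions telescope to [h (g b) - h (g a)], which is zero on a loop. *)
Lemma gradient_closed_loop (h : R * R -> R) (g : R -> R * R) a b :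
  is_gradient h F1 F2 -> closed_loop g a b -> line_integral F g a b = 0.
Proof.
move=> dh [ab [gab [n [t [t0 [tn pieces]]]]]].
suff : is_RInt (integrand g) a b (h (g b) - h (g a)).
  by rewrite gab Rminus_diag => /is_RInt_unique.
rewrite -t0 -tn.
have: (n <= n)%N by [].
elim: {-2}n => [|k IH] kn.
  rewrite Rminus_diag; exact: is_RInt_point.
have [tk [c1 c2]] := pieces k kn.
have -> : h (g (t k.+1)) - h (g (t 0%N)) =
  plus (h (g (t k)) - h (g (t 0%N))) (h (g (t k.+1)) - h (g (t k))).
  by rewrite /plus /=; ring.
apply: is_RInt_Chasles; first exact: IH (ltnW kn).
exact: gradient_line_integral_piece.
Qed.

Lemma horizontal_piece (g : R -> R * R) al be y c d : c <= d ->
  (forall t, Icc c d t -> g t = (al + be * t, y)) ->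
  is_RInt (integrand g) c d (RInt (fun s => F1 (s, y)) (al + be * c) (al + be * d)).
Proof.
move=> cd gE.
have cF s : continuous (fun s => F1 (s, y)) s.
  by apply: continuous_line1; apply: C1_plane_continuous.
apply: (is_RInt_ext (fun t => scal be (F1 (be * t + al, y)))).
  rewrite Rmin_left // Rmax_right // => t ht.
  have gt : g t = (al + be * t, y) by apply: gE; rewrite /Icc; lra.
  have d1 : is_derive (fun s => (g s).1) t be.
    by apply: (is_derive_affine _ al be c d) => // s hs; rewrite gE.
  have d2 : is_derive (fun s => (g s).2) t 0.
    by apply: (is_derive_affine _ y 0 c d) => // s hs; rewrite gE //=; ring.
  rewrite /integrand (is_derive_unique _ _ _ d1) (is_derive_unique _ _ _ d2) gt.
  by rewrite [be * t + al]Rplus_comm /scal /= /mult /=; ring.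
rewrite ![al + _]Rplus_comm.
apply: (is_RInt_comp_lin (fun s => F1 (s, y))); apply: RInt_correct.
by apply: ex_RInt_continuous.
Qed.

Lemma vertical_piece (g : R -> R * R) x al be c d : c <= d ->
  (forall t, Icc c d t -> g t = (x, al + be * t)) ->
  is_RInt (integrand g) c d (RInt (fun s => F2 (x, s)) (al + be * c) (al + be * d)).
Proof.
move=> cd gE.
have cF s : continuous (fun s => F2 (x, s)) s.
  by apply: continuous_line2; apply: C1_plane_continuous.
apply: (is_RInt_ext (fun t => scal be (F2 (x, be * t + al)))).
  rewrite Rmin_left // Rmax_right // => t ht.
  have gt : g t = (x, al + be * t) by apply: gE; rewrite /Icc; lra.
  have d1 : is_derive (fun s => (g s).1) t 0.
    by apply: (is_derive_affine _ x 0 c d) => // s hs; rewrite gE //=; ring.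
  have d2 : is_derive (fun s => (g s).2) t be.
    by apply: (is_derive_affine _ al be c d) => // s hs; rewrite gE.
  rewrite /integrand (is_derive_unique _ _ _ d1) (is_derive_unique _ _ _ d2) gt.
  by rewrite [be * t + al]Rplus_comm /scal /= /mult /=; ring.
rewrite ![al + _]Rplus_comm.
apply: (is_RInt_comp_lin (fun s => F2 (x, s))); apply: RInt_correct.
by apply: ex_RInt_continuous.
Qed.

End Loops.

(** One unit of time per side, starting at [(a, b)] along the horizontal side. *)
Definition rectangle_loop (a b x y t : R) : R * R :=
  if Rle_dec t 1 then (a + (x - a) * t, b)
  else if Rle_dec t 2 then (x, b + (y - b) * (t - 1))
  else if Rle_dec t 3 then (x + (a - x) * (t - 2), y)
  else (a, y + (b - y) * (t - 3)).

(** Each formula holds on its closed interval, both ends included: consecutive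
   sides agree at the corner where they meet. *)
Lemma rectangle_loop_pieces a b x y t :
  [/\ Icc 0 1 t -> rectangle_loop a b x y t = (a + (x - a) * t, b),
      Icc 1 2 t -> rectangle_loop a b x y t = (x, b - (y - b) + (y - b) * t),
      Icc 2 3 t -> rectangle_loop a b x y t = (x - 2 * (a - x) + (a - x) * t, y)
    & Icc 3 4 t -> rectangle_loop a b x y t = (a, y - 3 * (b - y) + (b - y) * t)].
Proof.
rewrite /rectangle_loop /Icc; split=> ht; case: Rle_dec => h1 /=; try lra.
- by [].
- by have -> : t = 1 by [lra]; congr (_, _); ring.
- by case: Rle_dec => h2 /=; [congr (_, _); ring|lra].
- case: Rle_dec => h2 /=; last by case: Rle_dec => h3 /=; [congr (_, _); ring|lra].
  by have -> : t = 2 by [lra]; congr (_, _); ring.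
- case: Rle_dec => h2 /=; first lra.
  case: Rle_dec => h3 /=; last by congr (_, _); ring.
  by have -> : t = 3 by [lra]; congr (_, _); ring.
Qed.

Lemma rectangle_loop_closed a b x y : closed_loop (rectangle_loop a b x y) 0 4.
Proof.
have P := rectangle_loop_pieces a b x y.
split; first lra; split.
  have [E0 _ _ _] := P 0; have [_ _ _ E4] := P 4.
  by rewrite E0 ?E4; [congr (_, _); ring| |]; rewrite /Icc; lra.
exists 4%N, INR; split=> //; split; first by rewrite /=; ring.
have C1 (g : R -> R * R) al1 be1 al2 be2 c d :
    (forall t, Icc c d t -> g t = (al1 + be1 * t, al2 + be2 * t)) ->
    C1_on (fun t => (g t).1) c d /\ C1_on (fun t => (g t).2) c d.
  move=> gE; split; [apply: (C1_on_affine _ al1 be1)|apply: (C1_on_affine _ al2 be2)];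
    by move=> t ht; rewrite gE.
move=> k hk; rewrite S_INR; split; first lra.
case: k hk => [|[|[|[|//]]]] _; rewrite /=.
- rewrite Rplus_0_l; apply: (C1 _ a (x - a) b 0) => t ht.
  by have [E _ _ _] := P t; rewrite E //; congr (_, _); ring.
- apply: (C1 _ x 0 (b - (y - b)) (y - b)) => t ht.
  by have [_ E _ _] := P t; rewrite E //; congr (_, _); ring.
- have -> : 1 + 1 + 1 = 3 by ring.
  apply: (C1 _ (x - 2 * (a - x)) (a - x) y 0) => t ht.
  by have [_ _ E _] := P t; rewrite E //; congr (_, _); ring.
- have [-> ->] : 1 + 1 + 1 = 3 /\ 3 + 1 = 4 by split; ring.
  apply: (C1 _ a 0 (y - 3 * (b - y)) (b - y)) => t ht.
  by have [_ _ _ E] := P t; rewrite E //; congr (_, _); ring.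
Qed.

Lemma rectangle_line_integral (F : R * R -> R * R) a b x y : C1_field F ->
  line_integral F (rectangle_loop a b x y) 0 4 =
    rectangle_integral (fun p => (F p).1) (fun p => (F p).2) a b x y.
Proof.
move=> [C1 C2]; have P := rectangle_loop_pieces a b x y.
apply: is_RInt_unique; rewrite /rectangle_integral.
have H := horizontal_piece F C1; have V := vertical_piece F C2.
apply: (is_RInt_Chasles _ _ 3); first apply: (is_RInt_Chasles _ _ 2);
  first apply: (is_RInt_Chasles _ _ 1).
- have := H (rectangle_loop a b x y) a (x - a) b 0 1.
  rewrite !(Rmult_0_r, Rmult_1_r, Rplus_0_r, Rplus_minus); apply; first lra.
  by move=> t; case: (P t).
- have := V (rectangle_loop a b x y) x (b - (y - b)) (y - b) 1 2.
  have -> : b - (y - b) + (y - b) * 1 = b by ring.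
  have -> : b - (y - b) + (y - b) * 2 = y by ring.
  by apply; [lra|move=> t; case: (P t)].
- have := H (rectangle_loop a b x y) (x - 2 * (a - x)) (a - x) y 2 3.
  have -> : x - 2 * (a - x) + (a - x) * 2 = x by ring.
  have -> : x - 2 * (a - x) + (a - x) * 3 = a by ring.
  by apply; [lra|move=> t; case: (P t)].
- have := V (rectangle_loop a b x y) a (y - 3 * (b - y)) (b - y) 3 4.
  have -> : y - 3 * (b - y) + (b - y) * 3 = y by ring.
  have -> : y - 3 * (b - y) + (b - y) * 4 = b by ring.
  by apply; [lra|move=> t; case: (P t)].
Qed.

(** A curl-free field has a potential, whose gradient integrates to zero around
   every loop; conversely, rectangles with a corner at the origin detect a nonzero
   curl. *)
Lemma closed_loop_curl (F : R * R -> R * R) : C1_field F ->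
  (exists (a b : R) (g : R -> R * R),
     closed_loop g a b /\ line_integral F g a b <> 0) <->
  ~ (forall p, curl F p = 0).
Proof.
move=> CF; have [C1 C2] := CF; split.
  move=> [a [b [g [cl ne]]]] curl0; apply: ne.
  apply: gradient_closed_loop cl => //; apply: curl0_gradient => // p.
  exact: Rminus_diag_uniq (curl0 p).
move=> ncurl; apply: NNPP => none; apply: ncurl => p; apply: Rminus_diag_eq.
apply: (rectangle_integral_curl _ _ C1 C2 0 0) => x y.
rewrite -rectangle_line_integral //; apply: NNPP => ne; apply: none.
exists 0, 4, (rectangle_loop 0 0 x y); split=> //; exact: rectangle_loop_closed.
Qed.

(** * Operations on piecewise continuous inputs *)

Lemma piecewise_cat P a b c : piecewise P a b -> piecewise P b c -> piecewise P a c.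
Proof.
move=> [n [t [t0 [tn ht]]]] [n' [t' [t0' [tn' ht']]]].
exists (n + n')%N, (fun k => if (k <= n)%N then t k else t' (k - n)%N).
split=> //; split.
  case: leqP => h; last by rewrite addKn.
  have n0 : n' = 0%N by apply/eqP; move: h; rewrite -{2}[n]addn0 leq_add2l leqn0.
  by rewrite n0 addn0 tn -t0' -tn' n0.
move=> k; case: (ltngtP k n) => [h|h|->] kn.
- exact: ht.
- by rewrite subSn ?(ltnW h) //; apply: ht'; rewrite ltn_subLR // ltnW.
- rewrite subSnn tn -t0'; apply: ht'.
  by move: kn; rewrite -{1}[n]addn0 ltn_add2l.
Qed.

Lemma piecewise_translate (P Q : R -> R -> Prop) a b tau :
  (forall c d, c < d -> P c d -> Q (c + tau) (d + tau)) ->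
  piecewise P a b -> piecewise Q (a + tau) (b + tau).
Proof.
move=> PQ [n [t [t0 [tn ht]]]]; exists n, (fun k => t k + tau).
rewrite t0 tn; split=> //; split=> // k kn.
by have [lt Pk] := ht k kn; split; [lra|exact: PQ].
Qed.

Lemma piecewise_mono (P Q : R -> R -> Prop) a b :
  (forall c d, a <= c -> c < d -> d <= b -> P c d -> Q c d) ->
  piecewise P a b -> piecewise Q a b.
Proof.
move=> PQ [n [t [t0 [tn ht]]]]; exists n, t; split=> //; split=> // k kn.
have [lt Pk] := ht k kn; split=> //.
have mono i j : (i <= j)%N -> (j <= n)%N -> t i <= t j.
  elim: j => [|j IH]; first by rewrite leqn0 => /eqP -> _; lra.
  rewrite leq_eqVlt => /predU1P [-> _|ij jn]; first lra.
  by have [? _] := ht j jn; have := IH ij (ltnW jn); lra.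
by apply: PQ => //; rewrite -?t0 -?tn; apply: mono => //; exact: ltnW.
Qed.

(** The endpoints are excluded because the value of an input there is free. *)
Lemma continuous_piece_ext (v w : R -> R) c d : c < d ->
  (forall t, c < t < d -> v t = w t) ->
  continuous_piece v c d -> continuous_piece w c d.
Proof.
move=> cd vw [cv [[l hl] [r hr]]]; split; last split.
- move=> t ht; apply: continuous_ext_loc (cv t ht).
  by apply: filter_imp (locally_open_interval _ _ _ ht).
- exists l; apply: filterlim_ext_loc hl.
  have cd0 : 0 < d - c by lra.
  exists (mkposreal _ cd0) => t /=.
  rewrite /ball /= /AbsRing_ball /abs /minus /plus /opp /= => /Rabs_def2 ht ct.
  by apply: vw; lra.
- exists r; apply: filterlim_ext_loc hr.
  have cd0 : 0 < d - c by lra.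
  exists (mkposreal _ cd0) => t /=.
  rewrite /ball /= /AbsRing_ball /abs /minus /plus /opp /= => /Rabs_def2 ht ct.
  by apply: vw; lra.
Qed.

Lemma continuous_translate tau t : continuous (fun s => s - tau) t.
Proof.
by apply: (continuous_minus (fun s => s)); [exact: continuous_id|exact: continuous_const].
Qed.

Lemma continuous_piece_translate (v : R -> R) c d tau :
  continuous_piece v c d ->
  continuous_piece (fun t => v (t - tau)) (c + tau) (d + tau).
Proof.
have ctr e : filterlim (fun s => s - tau) (locally (e + tau)) (locally e).
  by have := continuous_translate tau (e + tau); rewrite /continuous; have -> : e + tau - tau = e by ring.
move=> [cv [[l hl] [r hr]]]; split; last split.
- move=> t ht; apply: (continuous_comp (fun s => s - tau)).
    exact: continuous_translate.
  by apply: cv; lra.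
- exists l; apply: (filterlim_comp _ _ _ (fun s => s - tau) v) hl => P hP.
  have := ctr c _ hP; rewrite /filtermap /at_right /at_left /within.
  by apply: filter_imp => s Ps cs; apply: Ps; lra.
- exists r; apply: (filterlim_comp _ _ _ (fun s => s - tau) v) hr => P hP.
  have := ctr d _ hP; rewrite /filtermap /at_right /at_left /within.
  by apply: filter_imp => s Ps cs; apply: Ps; lra.
Qed.

Lemma piecewise_continuous_off_finite (v : R -> R) a b :
  piecewise_continuous v a b ->
  exists L, forall t, a < t < b -> ~ In t L -> continuous v t.
Proof.
move=> [n [t [<- [<- ht]]]].
have: (n <= n)%N by [].
elim: {-2}n => [|k IH] kn; first by exists nil => s hs; lra.
have [L hL] := IH (ltnW kn); have [_ [cv _]] := ht k kn.
exists (t k :: L) => s hs ns.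
case: (total_order_T s (t k)) => [[sk|sk]|sk].
- by apply: hL => [|hin]; [lra|apply: ns; right].
- by case: ns; left.
- by apply: cv; lra.
Qed.

(** * Reachability is transitive *)

Section Reachability.

Variables (I J : Type) (G : (I -> R) -> (J -> R) -> (I -> R)).

Definition reachable (p q : I -> R) : Prop :=
  exists (T : R) (u : R -> J -> R) (x : R -> I -> R),
    0 < T /\ (forall j : J, piecewise_continuous (fun t => u t j) 0 T) /\
    trajectory G T u x /\ x 0 = p /\ x T = q.

(** Run [y1] until time [T], then [y2] with its clock reset; the value at the
   junction is a separate parameter. *)
Definition glue {A : Type} (T : R) (y1 : R -> A) (v : A) (y2 : R -> A) (t : R) : A :=
  match total_order_T t T with
  | inleft (left _) => y1 t
  | inleft (right _) => v
  | inright _ => y2 (t - T)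
  end.

Lemma glue_lt {A : Type} T (y1 : R -> A) v y2 t : t < T -> glue T y1 v y2 t = y1 t.
Proof. by rewrite /glue; case: total_order_T => [[]|] //; lra. Qed.

Lemma glue_eq {A : Type} T (y1 : R -> A) v y2 : glue T y1 v y2 T = v.
Proof. by rewrite /glue; case: total_order_T => [[]|] //; lra. Qed.

Lemma glue_gt {A : Type} T (y1 : R -> A) v y2 t : T < t -> glue T y1 v y2 t = y2 (t - T).
Proof. by rewrite /glue; case: total_order_T => [[]|] //; lra. Qed.

(** The left limit at the junction can agree with at most one of the values 0
   and 1. *)
Lemma exists_jump_value (w1 w2 : R -> R) T :
  exists v, ~ continuous (glue T w1 v w2) T.
Proof.
have [c0|] := classic (continuous (glue T w1 0 w2) T); last by exists 0.
exists 1 => c1; suff : 0 = 1 by lra.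
have left v : continuous (glue T w1 v w2) T -> filterlim w1 (at_left T) (locally v).
  rewrite /continuous glue_eq => cv.
  apply: (filterlim_within_ext _ (glue T w1 v w2)); first exact: glue_lt.
  exact: filterlim_filter_le_1 _ (filter_le_within _) cv.
exact: (filterlim_locally_unique w1 0 1 (left 0 c0) (left 1 c1)).
Qed.

(** Gluing two trajectories produces a corner in the state at the junction.  The
   differential equation need not hold there as long as the glued input is
   discontinuous there, so one component of the input gets a value at the junction
   which forces a jump. *)
Lemma reachable_trans (j0 : J) p q r :
  reachable p q -> reachable q r -> reachable p r.
Proof.
move=> [T1 [u1 [x1 [T1p [pu1 [[cx1 dx1] [x1p x1q]]]]]]].
move=> [T2 [u2 [x2 [T2p [pu2 [[cx2 dx2] [x2q x2r]]]]]]].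
have [v nv] := exists_jump_value (fun s => u1 s j0) (fun s => u2 s j0) T1.
set u := glue T1 u1 (fun=> v) u2; set x := glue T1 x1 q x2.
exists (T1 + T2), u, x; split; first lra.
have u_j j t : u t j = glue T1 (fun s => u1 s j) v (fun s => u2 s j) t.
  by rewrite /u /glue; case: total_order_T => [[]|].
split; [|split; [split|split]].
- move=> j; apply: (piecewise_cat _ _ T1).
    apply: piecewise_mono (pu1 j) => c d _ cd dT; apply: continuous_piece_ext => // t ht.
    by rewrite u_j glue_lt //; lra.
  rewrite -{1}[T1]Rplus_0_l [T1 + T2]Rplus_comm.
  apply: (piecewise_translate (fun c d => 0 <= c /\ continuous_piece (fun t => u2 t j) c d)).
    move=> c d cd [c0 pc].
    apply: continuous_piece_ext (continuous_piece_translate _ _ _ T1 pc); first lra.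
    by move=> t ht; rewrite u_j glue_gt //; lra.
  by apply: piecewise_mono (pu2 j).
- have addK a b : a + b - b = a by ring.
  have addK' a b : b + a - b = a by ring.
  move=> k.
  (* Once clamped, the first trajectory stays at [q] after time [T1], and the second
     one before it, so subtracting [q] leaves the glued trajectory. *)
  apply: (continuous_on_ext (Icc 0 (T1 + T2))
    (fun t => x1 (clamp 0 T1 t) k + x2 (clamp 0 T2 (t - T1)) k - q k)).
    move=> t ht; rewrite /x; case: (total_order_T t T1) => [[h|->]|h].
    + rewrite glue_lt // clamp_id /Icc; last by move: ht; rewrite /Icc; lra.
      by rewrite clamp_below; [rewrite x2q; exact: addK|lra|lra].
    + rewrite glue_eq clamp_id /Icc; last lra.
      by rewrite clamp_below; [rewrite x2q x1q; exact: addK|lra|lra].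
    + rewrite glue_gt // clamp_above; [|lra|lra].
      by rewrite clamp_id /Icc; [rewrite x1q; exact: addK'|move: ht; rewrite /Icc; lra].
  apply: continuous_on_forall => t _.
  apply: (continuous_minus (fun t => x1 (clamp 0 T1 t) k + x2 (clamp 0 T2 (t - T1)) k)
    (fun=> q k)); last exact: continuous_const.
  apply: (continuous_plus (fun t => x1 (clamp 0 T1 t) k)
    (fun t => x2 (clamp 0 T2 (t - T1)) k)).
    by apply: (continuous_on_clamp (fun t => x1 t k)); [lra|].
  apply: (continuous_comp (fun t => t - T1) (fun s => x2 (clamp 0 T2 s) k)); first exact: continuous_translate.
  by apply: (continuous_on_clamp (fun t => x2 t k)); [lra|].
- move=> t ht cu k; case: (total_order_T t T1) => [[h|tT]|h].
  + have near : locally t (fun s => 0 < s < T1).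
      by apply: locally_open_interval; lra.
    rewrite /x /u !glue_lt //.
    apply: (is_derive_ext_loc (fun s => x1 s k)).
      by apply: filter_imp near => s hs; rewrite glue_lt //; lra.
    apply: dx1 => [|j]; first lra.
    apply: continuous_ext_loc (cu j).
    by apply: filter_imp near => s hs; rewrite u_j glue_lt //; lra.
  + case: nv; rewrite -tT; apply: continuous_ext (cu j0) => s; by rewrite u_j tT.
  + have near : locally t (fun s => T1 < s < T1 + T2).
      by apply: locally_open_interval; lra.
    rewrite /x /u !glue_gt //.
    apply: (is_derive_ext_loc (fun s => x2 (s - T1) k)).
      by apply: filter_imp near => s hs; rewrite glue_gt //; lra.
    rewrite -[G _ _ k]Rmult_1_l.
    apply: (is_derive_comp (fun s => x2 s k) (fun s => s - T1)); last by auto_derive.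
    apply: dx2 => [|j]; first lra.
    have near' : locally (t - T1) (fun s => 0 < s < T2).
      by apply: locally_open_interval; lra.
    apply: (continuous_ext_loc _ (fun s => u (s - - T1) j)).
      apply: filter_imp near' => s hs; rewrite u_j glue_gt; last lra.
      by congr (u2 _ j); ring.
    apply: (continuous_comp (fun s => s - - T1) (fun s => u s j)); first exact: continuous_translate.
    by have -> : t - T1 - - T1 = t by ring.
- by rewrite /x glue_lt.
- by rewrite /x glue_gt; [have -> : T1 + T2 - T1 = T2 by ring|lra].
Qed.

End Reachability.

Arguments reachable {I J} G p q.

(** * Controllability excludes a vanishing curl *)

Section System.

Variables (m : nat) (f : 'I_m -> R * R -> R).
Hypothesis hf : forall i j : 'I_m, (i < j)%N -> C1_field (pair_field f i j).

Notation state := (state_index m -> R).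

Let C1_fst (i j : 'I_m) (ij : (i < j)%N) : C1_plane (f i) := proj1 (hf i j ij).
Let C1_snd (i j : 'I_m) (ij : (i < j)%N) : C1_plane (f j) := proj2 (hf i j ij).

(** If [phi] is a potential of the field of the pair [(i, j)], then
   [x_ij - phi (x_i, x_j)] is a first integral of the system.  It takes different
   values at the origin and at the state that differs from it only in the
   coordinates of pairs. *)
Lemma controllable_curl (i j : 'I_m) : (i < j)%N -> controllable (system f) ->
  ~ (forall p, curl (pair_field f i j) p = 0).
Proof.
move=> ij ctrl curl0.
have C1i := C1_fst i j ij; have C1j := C1_snd i j ij.
set phi := corner_integral (f i) (f j) 0 0.
have dphi : is_gradient phi (f i) (f j).
  by apply: curl0_gradient => // p; exact: Rminus_diag_uniq (curl0 p).
have cfi p : continuous (f i) p by apply: C1_plane_continuous.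
pose K : state_index m := inr (exist (fun ij : 'I_m * 'I_m => (ij.1 < ij.2)%N) (i, j) ij).
have [T [u [x [T0 [pu [[cx dx] [xp xq]]]]]]] :=
  ctrl (fun=> 0) (fun k => if k is inr _ then 1 else 0).
have [L hL] : exists L, forall t, 0 < t < T -> ~ In t L ->
    forall k : 'I_m, continuous (fun s => u s k) t.
  suff [L hL] : exists L, forall t, 0 < t < T -> ~ In t L ->
      forall k, k \in enum 'I_m -> continuous (fun s => u s k) t.
    by exists L => t ht ns k; apply: hL => //; rewrite mem_enum.
  elim: (enum 'I_m) => [|k s [L hL]]; first by exists nil.
  have [L' hL'] := piecewise_continuous_off_finite _ _ _ (pu k).
  exists (L' ++ L)%list => t ht ns l; rewrite in_cons => /predU1P [->|ls].
    by apply: hL' => // hin; apply: ns; apply/in_or_app; left.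
  by apply: hL => // hin; apply: ns; apply/in_or_app; right.
pose h t := x t K - phi (x t (inl i), x t (inl j)).
suff : h T = h 0 by rewrite /h xp xq /=; lra.
apply: (constant_off_finite L); first lra.
  apply: (continuous_on_comp_pair (fun p => p.1 - p.2)) => //.
    by move=> p; apply: continuous_minus; [exact: continuous_fst|exact: continuous_snd].
  apply: (continuous_on_comp_pair phi) => // -[a b].
  apply: differentiable_continuous; exact: gradient_differentiable dphi cfi.
move=> t ht ns; have dxt := dx t ht (hL t ht ns).
have := is_derive_minus _ _ _ _ _ (dxt K)
  (gradient_chain _ _ _ _ _ _ _ _ dphi cfi (dxt (inl i)) (dxt (inl j))).
by rewrite /= /minus /plus /opp /= Rplus_opp_r.
Qed.

Lemma system_ext (x y : state) u k : (forall a, x (inl a) = y (inl a)) ->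
  system f x u k = system f y u k.
Proof. by move=> xy; case: k => [//|[[a b] ab]] /=; rewrite !xy. Qed.

(** * Moving one position at a time *)

Definition unit_input (i : 'I_m) : 'I_m -> R := fun j => if j == i then 1 else 0.

Definition put (i : 'I_m) (s : R) (p : state) : state :=
  fun k => if k is inl a then if a == i then s else p (inl a) else p k.

(** The velocity of coordinate [k] at the moment when position [i] passes through
   [s] at unit speed, the other positions being those of [p]. *)
Definition rate (i : 'I_m) (p : state) (k : state_index m) (s : R) : R :=
  system f (put i s p) (unit_input i) k.

(** The final state when position [i] travels along a segment to [be] and all
   other positions stay fixed. *)
Definition move_coord (i : 'I_m) (be : R) (p : state) : state :=
  fun k => p k + RInt (rate i p k) (p (inl i)) be.

Lemma move_coord_inl i be p a :
  move_coord i be p (inl a) = if a == i then be else p (inl a).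
Proof.
rewrite /move_coord /rate /= RInt_const /scal /= /mult /= /unit_input.
by case: eqP => [->|_]; ring.
Qed.

Lemma continuous_rate i p k s : continuous (rate i p k) s.
Proof.
case: k => [a|[[a b] /= ab]]; first exact: continuous_const.
have cput c : continuous (fun s => put i s p (inl c)) s.
  rewrite /=; case: (c == i); [exact: continuous_id|exact: continuous_const].
have cf c : C1_plane (f c) ->
    continuous (fun s => f c (put i s p (inl a), put i s p (inl b))) s.
  move=> Cc; apply: (continuous_comp_2 _ _ (fun u v => f c (u, v))) => //.
  by apply: continuous_ext (C1_plane_continuous _ _ Cc) => -[].
by apply: (continuous_plus (fun s => _ * _) (fun s => _ * _));
  apply: (continuous_mult _ (fun=> _)); try exact: continuous_const;
  apply: cf; [exact: C1_fst ab|exact: C1_snd ab].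
Qed.

Lemma ex_RInt_rate i p k a b : ex_RInt (rate i p k) a b.
Proof. by apply: ex_RInt_continuous => s _; apply: continuous_rate. Qed.

Lemma rate_ext i (p q : state) k s : (forall a, a != i -> p (inl a) = q (inl a)) ->
  rate i p k s = rate i q k s.
Proof.
move=> pq; apply: system_ext => a /=.
by case: eqVneq => // ai; apply: pq.
Qed.

Lemma system_scale x c u k :
  system f x (fun j => c * u j) k = c * system f x u k.
Proof. by case: k => [//|[[a b] ab]] /=; ring. Qed.

(** The input is constant on the unit time interval, and the state at time [t] is
   the result of the partial move to the point reached so far. *)
Lemma reachable_move i be p : reachable (system f) p (move_coord i be p).
Proof.
set al := p (inl i); set v := be - al.
pose x t := move_coord i (al + t * v) p.
have dx t k : is_derive (fun s => x s k) t (v * rate i p k (al + t * v)).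
  rewrite -[X in is_derive _ _ X]Rplus_0_l.
  apply: (is_derive_plus (fun=> p k)); first exact: is_derive_const.
  apply: (is_derive_comp (RInt (rate i p k) al) (fun s => al + s * v)).
    by apply: continuous_RInt_is_derive => s; apply: continuous_rate.
  by auto_derive; lra.
exists 1, (fun _ j => v * unit_input i j), x.
split; first lra; split; [|split; [split|split]].
- move=> j; exists 1%N, INR; split=> //; split=> // k; rewrite ltnS leqn0 => /eqP -> /=.
  split; first lra; split; first by move=> t _; apply: continuous_const.
  by split; exists (v * unit_input i j); apply: filterlim_const.
- move=> k; apply: continuous_on_forall => t _.
  by apply: (ex_derive_continuous (fun s => x s k)); exists (v * rate i p k (al + t * v)).
- move=> t _ _ k; rewrite system_scale.
  have -> : system f (x t) (unit_input i) k = rate i p k (al + t * v).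
    by apply: system_ext => a; rewrite /x move_coord_inl.
  exact: dx.
- apply: functional_extensionality => k; rewrite /x Rmult_0_l Rplus_0_r.
  by rewrite /move_coord RInt_point Rplus_0_r.
- by rewrite /x /v; congr (move_coord i _ p); ring.
Qed.

Lemma move_coord_back i be p : move_coord i (p (inl i)) (move_coord i be p) = p.
Proof.
apply: functional_extensionality => k.
rewrite {1}/move_coord move_coord_inl eqxx /move_coord.
rewrite (RInt_ext (rate i (move_coord i be p) k) (rate i p k)); last first.
  by move=> s _; apply: rate_ext => a ai; rewrite move_coord_inl (negbTE ai).
rewrite -[RInt _ be _]opp_RInt_swap; last exact: ex_RInt_rate.
by rewrite /opp /=; ring.
Qed.

(** Reachability in both directions, so that a sequence of moves that adds some
   amount to a coordinate also allows the same amount to be subtracted. *)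
Definition linked (p q : state) : Prop :=
  reachable (system f) p q /\ reachable (system f) q p.

Lemma linked_move i be p : linked p (move_coord i be p).
Proof.
split; first exact: reachable_move.
by rewrite -{2}(move_coord_back i be p); apply: reachable_move.
Qed.

(** The index [i] names the component of the input that jumps at the junction in
   [reachable_trans]. *)
Lemma linked_trans (i : 'I_m) p q r : linked p q -> linked q r -> linked p r.
Proof.
move=> [pq qp] [qr rq].
by split; [exact: reachable_trans i _ _ _ pq qr|exact: reachable_trans i _ _ _ rq qp].
Qed.

(** * Controllability from rectangles *)

Definition bump (i j : 'I_m) (w : R) (p : state) : state :=
  fun k => p k + (if k is inr kl then if sval kl == (i, j) then w else 0 else 0).

Lemma bump_inl i j w p a : bump i j w p (inl a) = p (inl a).
Proof. exact: Rplus_0_r. Qed.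

Lemma bump_add i j w w' p : bump i j w (bump i j w' p) = bump i j (w' + w) p.
Proof.
apply: functional_extensionality => -[a|kl]; rewrite /bump; first by ring.
by case: ifP => _; ring.
Qed.

Lemma bump0 i j p : bump i j 0 p = p.
Proof.
apply: functional_extensionality => -[a|kl]; rewrite /bump; first by ring.
by case: ifP => _; ring.
Qed.

(** While position [i] moves, coordinate [x_kl] depends on position [j] only if
   [{k, l} = {i, j}]: it is at rest when [i] is not in [{k, l}], and does not see [j]
   when [j] is not in [{k, l}]. *)
Lemma rate_other i j (p q : state) kl s : i != j ->
  sval kl != (i, j) -> sval kl != (j, i) ->
  (forall a, a != j -> p (inl a) = q (inl a)) ->
  rate i p (inr kl) s = rate i q (inr kl) s.
Proof.
case: kl => -[a b] ab /= ij; rewrite !xpair_eqE /rate /= /unit_input => nij nji pq.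
have [ai|ai] := eqVneq a i.
  by move: nij; rewrite ai eqxx /= => bj; case: eqP => // _; rewrite pq.
have [bi|bi] := eqVneq b i; last by ring.
by move: nji; rewrite bi eqxx andbT => aj; rewrite pq.
Qed.

(** For the pair [(i, j)] the four increments are the sides of the circulation.
   For any other pair, opposite sides are the same integral traversed in opposite
   directions and cancel, by [rate_other]. *)
Lemma rectangle_moves (i j : 'I_m) (x y : R) (p : state) : (i < j)%N ->
  let W := rectangle_integral (f i) (f j) (p (inl i)) (p (inl j)) x y in
  move_coord j (p (inl j)) (move_coord i (p (inl i))
    (move_coord j y (move_coord i x p))) = bump i j W p.
Proof.
move=> ij W; have nij : i != j by rewrite neq_ltn ij.
have nji : j != i by rewrite eq_sym.
set c := p (inl i); set d := p (inl j).
set p1 := move_coord i x p; set p2 := move_coord j y p1; set p3 := move_coord i c p2.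
have p1E a : p1 (inl a) = if a == i then x else p (inl a) by exact: move_coord_inl.
have p2E a : p2 (inl a) = if a == j then y else p1 (inl a) by exact: move_coord_inl.
have p3E a : p3 (inl a) = if a == i then c else p2 (inl a) by exact: move_coord_inl.
apply: functional_extensionality => -[a|kl].
  rewrite move_coord_inl bump_inl p3E p2E p1E.
  have [->|aj] := eqVneq a j => //.
  by have [->|ai] := eqVneq a i.
have -> : move_coord j d p3 (inr kl) = p (inr kl)
    + (RInt (rate i p (inr kl)) c x + RInt (rate j p1 (inr kl)) d y
    + RInt (rate i p2 (inr kl)) x c + RInt (rate j p3 (inr kl)) y d).
  rewrite /move_coord p3E (negbTE nji) p2E eqxx -/p3.
  rewrite {1}/p3 /move_coord p2E (negbTE nij) p1E eqxx.
  rewrite {1}/p2 /move_coord p1E (negbTE nji) -/d {1}/p1 /move_coord -/c.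
  by ring.
rewrite /bump; congr (_ + _).
have [klE|nkl] := eqVneq (sval kl) (i, j).
  rewrite /W /rectangle_integral -/c -/d.
  case: kl klE => -[a b] ab /= [ai bj].
  have ei q s : rate i q (inr (exist _ (a, b) ab)) s = f i (s, q (inl j)).
    rewrite /rate /= ai bj eqxx (negbTE nji) /unit_input eqxx (negbTE nji); ring.
  have ej q s : rate j q (inr (exist _ (a, b) ab)) s = f j (q (inl i), s).
    rewrite /rate /= ai bj eqxx (negbTE nij) /unit_input eqxx (negbTE nij); ring.
  congr (_ + _ + _ + _); apply: RInt_ext => s _.
  - by rewrite ei.
  - by rewrite ej p1E eqxx.
  - by rewrite ei p2E eqxx.
  - by rewrite ej p3E eqxx.
have nkl' : sval kl != (j, i).
  by case: kl {nkl} => -[a b] /= ab; rewrite xpair_eqE; apply/negP => /andP [/eqP aj /eqP bi];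
     move: ab; rewrite aj bi ltnNge ltnW.
rewrite (RInt_ext (rate i p2 _) (rate i p (inr kl))); last first.
  move=> s _; rewrite (rate_other i j p2 p1) // => [|a aj].
    by apply: rate_ext => a ai; rewrite p1E (negbTE ai).
  by rewrite p2E (negbTE aj).
rewrite (RInt_ext (rate j p3 _) (rate j p1 (inr kl))); last first.
  move=> s _; rewrite (rate_other j i p3 p2) // => [|a ai].
    by apply: rate_ext => a aj; rewrite p2E (negbTE aj).
  by rewrite p3E (negbTE ai).
rewrite -[RInt _ x c]opp_RInt_swap; last exact: ex_RInt_rate.
rewrite -[RInt _ y d]opp_RInt_swap; last exact: ex_RInt_rate.
by rewrite /opp /=; ring.
Qed.

Lemma linked_rectangle (i j : 'I_m) (x y : R) (p : state) : (i < j)%N ->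
  linked p (bump i j (rectangle_integral (f i) (f j) (p (inl i)) (p (inl j)) x y) p).
Proof.
move=> ij; rewrite -rectangle_moves //.
apply: (linked_trans i); last exact: linked_move.
apply: (linked_trans i); last exact: linked_move.
by apply: (linked_trans i); last exact: linked_move; exact: linked_move.
Qed.

(** By [rectangle_integral_curl], some rectangle with a corner at the current
   positions has nonzero circulation [W x y]; shrinking it to width zero realizes
   every amount between 0 and [W x y] by the intermediate value theorem.  The
   realizable amounts are closed under sum and opposite, and a subgroup of the reals
   containing a nontrivial interval is everything. *)
Lemma linked_bump (i j : 'I_m) (w : R) (p : state) : (i < j)%N ->
  ~ (forall r, curl (pair_field f i j) r = 0) -> linked p (bump i j w p).
Proof.
move=> ij ncurl.
have C1i := C1_fst i j ij; have C1j := C1_snd i j ij.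
set c := p (inl i); set d := p (inl j).
pose W := rectangle_integral (f i) (f j) c d.
have [x [y Wne]] : exists x y, W x y <> 0.
  apply: NNPP => none; apply: ncurl => r; apply: Rminus_diag_eq.
  apply: (rectangle_integral_curl _ _ C1i C1j c d) => x y.
  by apply: NNPP => ne; apply: none; exists x, y.
(* The amount must be realizable from every state over the positions [c] and [d],
   so that the moves can be repeated after the coordinate has changed. *)
pose S v := forall q : state, q (inl i) = c -> q (inl j) = d -> linked q (bump i j v q).
have W0 : W c y = 0.
  rewrite /W /rectangle_integral !RInt_point -(opp_RInt_swap _ d y).
    by rewrite /opp /zero /=; ring.
  apply: ex_RInt_continuous => s _.
  by apply: continuous_line2; apply: C1_plane_continuous.
have S_opp v : S v -> S (- v).
  move=> Sv q qi qj; have := Sv (bump i j (- v) q).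
  rewrite !bump_inl bump_add Rplus_opp_l bump0 => /(_ qi qj) [? ?]; by split.
have S_add v v' : S v -> S v' -> S (v + v').
  move=> Sv Sv' q qi qj; rewrite -bump_add.
  by apply: (linked_trans i); [exact: Sv|apply: Sv'; rewrite bump_inl].
have S_between v : Rmin 0 (W x y) <= v <= Rmax 0 (W x y) -> S v.
  rewrite -W0 => hv.
  have [|s [_ <-]] := IVT_gen (fun s => W s y) c x v _ hv.
    move=> s; apply/continuity_pt_filterlim.
    apply: (ex_derive_continuous (fun s => W s y)).
    by eexists; apply: rectangle_integral_partial1.
  by move=> q qi qj; rewrite /W -qi -qj; apply: linked_rectangle.
have S_small v : Rabs v <= Rabs (W x y) -> S v.
  move=> hv; have : S v \/ S (- v); last first.
    by move=> [//|/S_opp]; rewrite Ropp_involutive.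
  move: hv; rewrite /Rabs; case: Rcase_abs => ?; case: Rcase_abs => ? hv.
  - by left; apply: S_between; rewrite Rmin_right ?Rmax_left; lra.
  - by right; apply: S_between; rewrite Rmin_left ?Rmax_right; lra.
  - by right; apply: S_between; rewrite Rmin_right ?Rmax_left; lra.
  - by left; apply: S_between; rewrite Rmin_left ?Rmax_right; lra.
have S_pow n v : Rabs v <= 2 ^ n * Rabs (W x y) -> S v.
  elim: n v => [|n IH] v hv; first by apply: S_small; move: hv; rewrite /=; lra.
  have -> : v = v / 2 + v / 2 by field.
  have Sh : S (v / 2).
    apply: IH; rewrite Rabs_mult (Rabs_pos_eq (/ 2)); last lra.
    by move: hv; rewrite /=; lra.
  exact: S_add.
have W_pos : 0 < Rabs (W x y) by exact: Rabs_pos_lt.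
(* Doubling reaches [w] from the interval of amounts bounded by [W x y]. *)
have [n hn] := Pow_x_infinity 2 ltac:(rewrite Rabs_pos_eq; lra) (Rabs w / Rabs (W x y)).
apply: (S_pow n) => //.
have := hn n (le_n n); rewrite Rabs_pos_eq => [|]; last by apply: pow_le; lra.
move=> /Rge_le /(Rmult_le_compat_r _ _ _ (Rlt_le _ _ W_pos)).
by have -> : Rabs w / Rabs (W x y) * Rabs (W x y) = Rabs w by field; lra.
Qed.

Lemma linked_positions (i0 : 'I_m) (p q : state) :
  exists p', linked p p' /\ forall k, p' (inl k) = q (inl k).
Proof.
suff [p' [pp' hp']] : exists p', linked p p' /\
    forall k, k \in enum 'I_m -> p' (inl k) = q (inl k).
  by exists p'; split=> // k; apply: hp'; rewrite mem_enum.
elim: (enum 'I_m) => [|i s [p' [pp' hp']]].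
  exists (move_coord i0 (p (inl i0)) p); split=> //; exact: linked_move.
exists (move_coord i (q (inl i)) p'); split.
  by apply: (linked_trans i0) pp' _; exact: linked_move.
move=> k; rewrite in_cons move_coord_inl; case: eqP => [-> //|_] /=; exact: hp'.
Qed.

(** Bringing one pair to its target leaves the positions and all other pairs
   unchanged, so the pairs can be treated one after another. *)
Lemma curl_controllable (i0 : 'I_m) :
  (forall i j : 'I_m, (i < j)%N -> ~ (forall r, curl (pair_field f i j) r = 0)) ->
  controllable (system f).
Proof.
move=> ncurl p q; have [p0 [pp0 p0q]] := linked_positions i0 p q.
suff [p' [pp' [p'q hp']]] : exists p', linked p p' /\
    (forall k, p' (inl k) = q (inl k)) /\
    (forall kl : pair_index m, sval kl \in enum {: 'I_m * 'I_m} ->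
       p' (inr kl) = q (inr kl)).
  have <- : p' = q; last by case: pp'.
  apply: functional_extensionality => -[k|kl] //.
  by apply: hp'; rewrite mem_enum.
elim: (enum {: 'I_m * 'I_m}) => [|[i j] s [p' [pp' [p'q hp']]]].
  by exists p0.
have [ij|nij] := boolP (i < j)%N; last first.
  exists p'; split=> //; split=> // kl; rewrite in_cons => /orP [/eqP klE|]; last exact: hp'.
  by move: nij; have := svalP kl; rewrite klE /= => ->.
pose K : pair_index m := exist (fun ij : 'I_m * 'I_m => (ij.1 < ij.2)%N) (i, j) ij.
exists (bump i j (q (inr K) - p' (inr K)) p'); split; last split.
- by apply: (linked_trans i0) pp' _; apply: linked_bump => //; apply: ncurl.
- by move=> k; rewrite bump_inl.
- move=> kl; rewrite in_cons /bump; case: eqP => [klE _|_] /=; last first.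
    by rewrite Rplus_0_r; exact: hp'.
  have -> : kl = K by apply: val_inj.
  by ring.
Qed.

End System.

Theorem mainTheorem3 (m : nat) (hm : (2 <= m)%N) (f : 'I_m -> R * R -> R)
    (hf : forall i j : 'I_m, (i < j)%N -> C1_field (pair_field f i j)) :
  (controllable (system f) <->
   (forall i j : 'I_m, (i < j)%N ->
      exists (a b : R) (g : R -> R * R),
        closed_loop g a b /\ line_integral (pair_field f i j) g a b <> 0)) /\
  ((forall i j : 'I_m, (i < j)%N ->
      exists (a b : R) (g : R -> R * R),
        closed_loop g a b /\ line_integral (pair_field f i j) g a b <> 0) <->
   (forall i j : 'I_m, (i < j)%N ->
      ~ (forall p : R * R, curl (pair_field f i j) p = 0))).
Proof.
split; split.
- move=> ctrl i j ij; apply/(closed_loop_curl _ (hf i j ij)).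
  exact: (controllable_curl m f hf i j ij ctrl).
- move=> loops; apply: (curl_controllable m f hf (Ordinal (ltnW hm))) => i j ij.
  by apply/(closed_loop_curl _ (hf i j ij)); apply: loops.
- by move=> loops i j ij; apply/(closed_loop_curl _ (hf i j ij)); apply: loops.
- by move=> ncurl i j ij; apply/(closed_loop_curl _ (hf i j ij)); apply: ncurl.
Qed.
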